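(* Let $G$ be a graph of order $n$, let $l_{ij}$ denote the $(i,j)$-th entry of its Lanzhou matrix $A_{Lz}(G)$, and let $P=2\sum_{i<j} l_{ij}^2$. Then the Lanzhou energy satisfies $$\mathcal{E}_{Lz}(G)\leq \sqrt{nP}.$$
   Context: Graphs are finite, simple and undirected. For a graph $G$ on $n$ vertices, $d_G(u)$ is the degree of $u$ in $G$ and $d_{\overline{G}}(u)=n-1-d_G(u)$ is its degree in the complement $\overline{G}$. The Lanzhou matrix $A_{Lz}(G)$ is the real symmetric $n\times n$ matrix indexed by vertices whose $(u,v)$ entry is $d_G(u)d_{\overline{G}}(u)+d_G(v)d_{\overline{G}}(v)$ if $u$ and $v$ are adjacent in $G$, and $0$ otherwise. If its eigenvalues are $\lambda_1,\ldots,\lambda_n$ (with multiplicity), the Lanzhou energy is $\mathcal{E}_{Lz}(G)=\sum_{i=1}^n|\lambda_i|$. *)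

(* Defs.v *)
From HB Require Import structures.
From mathcomp Require Import all_boot all_order all_algebra.
From mathcomp Require Import reals complex.

Set Implicit Arguments.
Unset Strict Implicit.
Unset Printing Implicit Defensive.

Import Order.TTheory GRing.Theory Num.Theory.

Local Open Scope ring_scope.
Local Open Scope complex_scope.

Record sgraph := SGraph {
  vertex :> finType;
  adj : rel vertex;
  adj_sym : symmetric adj;
  adj_irr : irreflexive adj }.

Section Graph.
Variable G : sgraph.

Definition deg (u : G) : nat := #|[set v : G | adj u v]|.

Definition compl_adj : rel G := fun u v => (u != v) && ~~ adj u v.

Lemma compl_adj_sym : symmetric compl_adj.
Proof. by move=> u v; rewrite /compl_adj eq_sym adj_sym. Qed.

Lemma compl_adj_irr : irreflexive compl_adj.
Proof. by move=> u; rewrite /compl_adj eqxx. Qed.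

Definition compl : sgraph := SGraph compl_adj_sym compl_adj_irr.

End Graph.

Lemma deg_compl (G : sgraph) (u : G) :
  @deg (compl G) u = (#|G| - 1 - deg u)%N.
Proof.
have -> : @deg (compl G) u = #|~: [set v : G | adj u v] :\ u|.
  by apply: eq_card => v; rewrite !inE /= /compl_adj eq_sym.
rewrite -(cardsC [set v : G | adj u v]) (cardsD1 u (~: _)) !inE adj_irr.
by rewrite addnCA addKn addKn.
Qed.

Definition lz_weight (G : sgraph) (u : G) : nat :=
  (deg u * @deg (compl G) u)%N.

(* Rows and columns are numbered by the enumeration [enum_val] of the
   vertices, so that the entries l_ij with i < j make sense. *)
Definition lanzhou_mx (R : realType) (G : sgraph) : 'M[R]_#|G| :=
  \matrix_(i, j)
    if adj (enum_val i : G) (enum_val j)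
    then (lz_weight (enum_val i : G) + lz_weight (enum_val j : G))%:R
    else 0.

(* All complex eigenvalues of a real matrix, listed with algebraic
   multiplicity: the list has n elements and is unique up to order. *)
Definition eigenvalues (R : realType) (n : nat) (A : 'M[R]_n) : seq R[i] :=
  sval (closed_field_poly_normal (char_poly (map_mx (real_complex R) A))).

Lemma eigenvaluesP (R : realType) (n : nat) (A : 'M[R]_n) :
  char_poly (map_mx (real_complex R) A)
    = \prod_(z <- eigenvalues A) ('X - z%:P).
Proof.
rewrite /eigenvalues; case: closed_field_poly_normal => s /= {1}->.
by rewrite (monicP (char_poly_monic _)) scale1r.
Qed.

(* [`|z|] lives in R[i]; its real part is the modulus as an element of R. *)
Definition lanzhou_energy (R : realType) (G : sgraph) : R :=
  \sum_(z <- eigenvalues (lanzhou_mx R G)) complex.Re `|z|.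

(* Main.v *)
(* The Lanzhou matrix A is real symmetric, hence diagonalisable with real
   eigenvalues d_i, and sum_i |d_i|^2 = tr(A^2) is the sum of the squares of
   all entries of A, which is P since the diagonal vanishes. Cauchy-Schwarz
   then gives (sum_i |d_i|)^2 <= n P. *)
Require Import Defs.
From mathcomp Require Import all_boot all_order all_algebra.
From mathcomp Require Import reals.
From mathcomp Require Import complex.

Import Order.TTheory GRing.Theory Num.Theory.
Local Open Scope ring_scope.

(** Cauchy-Schwarz against the all-ones vector: sum [2 x_i x_j <= x_i^2 + x_j^2] over all ordered
    pairs. Doubling both sides avoids any division. *)
Lemma sqr_sum_le (R : realDomainType) (I : finType) (x : I -> R) :
  (\sum_i x i) ^+ 2 <= #|I|%:R * \sum_i x i ^+ 2.
Proof.
have: (\sum_i x i) ^+ 2 *+ 2 <= \sum_i \sum_j (x i ^+ 2 + x j ^+ 2).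
  rewrite expr2 mulr_suml -sumrMnl; apply: ler_sum => i _.
  rewrite mulr_sumr -sumrMnl; apply: ler_sum => j _.
  by rewrite -subr_ge0 addrAC -sqrrB sqr_ge0.
under [leRHS]eq_bigr do rewrite big_split /= sumr_const.
by rewrite big_split /= sumr_const sumrMnl -mulr2n lerMn2r mulr_natl.
Qed.

(** The scalar matrix [X] commutes with [V], so conjugation passes to the characteristic matrix over
    polynomials, where the determinants of [PW] and [PV] cancel. *)
Lemma char_poly_conj (F : fieldType) (n : nat) (V A : 'M[F]_n) :
  V \in unitmx -> char_poly (invmx V *m A *m V) = char_poly A.
Proof.
move=> Vu; pose PV := map_mx (@polyC F) V; pose PW := map_mx (@polyC F) (invmx V).
have WV : PW *m PV = 1%:M by rewrite -map_mxM mulVmx // map_mx1.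
have -> : char_poly (invmx V *m A *m V) = \det (PW *m char_poly_mx A *m PV).
  congr (\det _); rewrite /char_poly_mx mulmxBr mulmxBl !map_mxM.
  by rewrite mul_mx_scalar -scalemxAl WV scalemx1.
by rewrite !det_mulmx mulrAC -det_mulmx WV det1 mul1r.
Qed.

(** Links the spectral theorem to [eigenvalues], which is defined through roots of the
    characteristic polynomial. *)
Lemma char_poly_spectral (C : numClosedFieldType) (n : nat) (A : 'M[C]_n) :
  A \is normalmx ->
  char_poly A = \prod_(z <- codom (spectral_diag A 0)) ('X - z%:P).
Proof.
move=> /orthomx_spectralP A_eq; rewrite {1}A_eq char_poly_conj ?spectral_unit //.
rewrite char_poly_trig ?diag_mx_is_trig // big_image /=.
by apply: eq_bigr => i _; rewrite mxE eqxx.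
Qed.

Lemma sum_sqr_spectral (C : numClosedFieldType) (n : nat) (A : 'M[C]_n) :
  A \is normalmx -> \sum_i spectral_diag A 0 i ^+ 2 = \tr (A *m A).
Proof.
move=> /orthomx_spectralP A_eq; have Vu := spectral_unit A.
have -> : A *m A = invmx (spectralmx A) *m
    (diag_mx (spectral_diag A) *m diag_mx (spectral_diag A) *m spectralmx A).
  by rewrite {1 2}A_eq -!mulmxA mulKVmx.
rewrite mxtrace_mulC mulmxK // mulmx_diag mxtrace_diag.
by apply: eq_bigr => i _; rewrite mxE.
Qed.

Lemma mxtrace_sqr_sym (R : comPzRingType) (n : nat) (A : 'M[R]_n) :
  A^T = A -> (forall i, A i i = 0) ->
  \tr (A *m A) = 2 * \sum_(i < n) \sum_(j < n | (i < j)%N) A i j ^+ 2.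
Proof.
move=> Asym A0.
have Aji i j : A j i = A i j by rewrite -[in LHS]Asym mxE.
pose S := \sum_(i < n) \sum_(j < n | (i < j)%N) A i j ^+ 2.
(* By symmetry, the strict lower triangle contributes as much as the strict upper one. *)
have SE : \sum_(i < n) \sum_(j < n | (j < i)%N) A i j ^+ 2 = S.
  rewrite (exchange_big_dep predT) //=; apply: eq_bigr => j _.
  by apply: eq_bigr => i _; rewrite Aji.
rewrite -/S mulr_natl mulr2n -{1}SE -big_split /=; apply: eq_bigr => i _.
(* Row [i] loses its zero diagonal term and splits into its parts below and above the diagonal. *)
rewrite mxE (bigD1 i) //= A0 mul0r add0r (bigID (fun j : 'I_n => (j < i)%N)) /=.
congr GRing.add; apply: eq_big => j.
- by rewrite -val_eqE /=; case: ltngtP.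
- by rewrite (Aji i j) -expr2.
- by rewrite -val_eqE /=; case: ltngtP.
- by rewrite (Aji i j) -expr2.
Qed.

Lemma sum_norm_eigenvalues_le (R : realType) (n : nat) (A : 'M[R]_n) :
  A^T = A ->
  \sum_(z <- eigenvalues A) complex.Re `|z| <= Num.sqrt (n%:R * \tr (A *m A)).
Proof.
move=> Asym; pose B := map_mx (real_complex R) A.
have Bherm : B \is hermsymmx.
  apply: realsym_hermsym.
    apply/is_hermitianmxP; rewrite expr0 scale1r map_mx_id //.
    by rewrite map_trmx Asym.
  by apply/mxOverP => i j; rewrite mxE complex_real.
have Bnormal := hermitian_normalmx Bherm.
(* Both lists split the same polynomial into monic linear factors, so they agree up to order. *)
have eq_spec : perm_eq (eigenvalues A) (codom (spectral_diag B 0)).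
  by apply: prod_XsubC_eq; rewrite -eigenvaluesP char_poly_spectral.
(* Bounding the sum by its absolute value, the root of its square, leaves only radicands to
   compare. *)
rewrite (perm_big _ eq_spec) big_image /=; apply: le_trans (ler_norm _) _.
rewrite -sqrtr_sqr ler_wsqrtr //; apply: le_trans (sqr_sum_le _ _ _) _.
rewrite card_ord ler_wpM2l ?ler0n //.
suff -> : \tr (A *m A) = \sum_i complex.Re `|spectral_diag B 0 i| ^+ 2 by [].
(* The identity is checked in [R[i]], where the spectral values live. *)
apply: (@complexI R); transitivity (\tr (B *m B)).
  by rewrite -map_mxM trace_map_mx.
rewrite -sum_sqr_spectral // rmorph_sum; apply: eq_bigr => i _.
have /mxOverP /(_ 0 i) d_real := hermitian_spectral_diag_real Bherm.
(* A real [d] satisfies [|d|^2 = d^2], and the norm in [R[i]] is already the embedding of its real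
   part. *)
by rewrite rmorphXn -(real_normK d_real).
Qed.

Theorem theorem27 (R : realType) (G : sgraph) (n : nat) (hn : #|G| = n) (P : R)
    (hP : P = 2 * \sum_(i < #|G|) \sum_(j < #|G| | (i < j)%N)
                    lanzhou_mx R G i j ^+ 2) :
  lanzhou_energy R G <= Num.sqrt (n%:R * P).
Proof.
have Asym : (lanzhou_mx R G)^T = lanzhou_mx R G.
  by apply/matrixP => i j; rewrite !mxE adj_sym addnC.
have A0 i : lanzhou_mx R G i i = 0 by rewrite mxE adj_irr.
by rewrite hP -mxtrace_sqr_sym // -hn; apply: sum_norm_eigenvalues_le.
Qed.
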